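(* Let $F\colon\Omega\to\Omega$ be a piecewise translation in $\mathbb{R}^d$ with $m=d+1$ branches, translation vectors $v_0,\dots,v_d$ with $v_1-v_0,\dots,v_d-v_0$ linearly independent, and suppose the torus rotation $R$ is ergodic. For $\phi\in\mathbb{T}$ let $\xi(\phi)=\#\big(\pi^{-1}(\phi)\cap A\big)$. Then $\xi$ is constant (and finite) for Lebesgue-almost every $\phi\in\mathbb{T}$.
   Context: A region is a compact subset of $\mathbb{R}^d$ which equals the closure of its interior. A piecewise translation with $m$ branches: $\Omega\subset\mathbb{R}^d$ is a region, $\Omega=P_0\cup\dots\cup P_{m-1}$ with each $P_i$ a region, distinct $P_i$ intersecting only in boundaries, $\mathrm{Leb}(\partial P_i)=0$; vectors $v_i$ satisfy $x+v_i\in\Omega$ for $x\in P_i$; $i(x)$ is an index with $x\in P_{i(x)}$ (boundary ambiguity resolved by a fixed measurable rule), and $F(x)=x+v_{i(x)}$. $\Omega_0=\Omega$, $\Omega_n=\overline{F(\Omega_{n-1})}$, $A=\bigcap_n\Omega_n$ is the attractor. $\mathcal{L}$ is the lattice generated by $v_1-v_0,\dots,v_d-v_0$, $\mathbb{T}=\mathbb{R}^d/\mathcal{L}$, $\pi\colon\mathbb{R}^d\to\mathbb{T}$ the projection, $R(\phi)=\phi+\pi(v_0)$ on $\mathbb{T}$. *)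

(* Defs.v *)
From HB Require Import structures.
From mathcomp Require Import all_boot all_order all_algebra.
From mathcomp Require Import all_classical all_reals all_analysis.
Set Implicit Arguments. Unset Strict Implicit. Unset Printing Implicit Defensive.
Import Order.TTheory GRing.Theory Num.Theory.
Import numFieldNormedType.Exports.
Local Open Scope classical_set_scope.
Local Open Scope ring_scope.

Section Defs.
Variables (R : realType) (d : nat).
Notation vec := 'rV[R]_d.

Definition box (lo hi : vec) : set vec :=
  [set x | forall i : 'I_d, lo 0 i <= x 0 i <= hi 0 i].

Definition box_vol (lo hi : vec) : R :=
  \prod_(i < d) Num.max 0 (hi 0 i - lo 0 i).

(* a countable cover by boxes; [None] = no box (allows finite covers) *)
Definition cbox (b : option (vec * vec)) : set vec :=
  if b is Some (lo, hi) then box lo hi else set0.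
Definition cvol (b : option (vec * vec)) : R :=
  if b is Some (lo, hi) then box_vol lo hi else 0.

Definition leb_outer (E : set vec) : \bar R :=
  ereal_inf [set s : \bar R | exists c : nat -> option (vec * vec),
     E `<=` \bigcup_k cbox (c k) /\
     s = (\sum_(0 <= k <oo) (cvol (c k))%:E)%E].

Definition leb_null (E : set vec) : Prop := leb_outer E = 0%E.

Definition leb_measurable (E : set vec) : Prop :=
  caratheodory_measurable leb_outer E.

Definition region (K : set vec) : Prop :=
  compact K /\ closure (interior K) = K.

Definition boundary (S : set vec) : set vec := closure S `\` interior S.

Definition piecewise_translation (m : nat) (Omega : set vec)
  (P : 'I_m -> set vec) (v : 'I_m -> vec) (idx : vec -> 'I_m) : Prop :=
  [/\ region Omega,
      Omega = \bigcup_(i in [set: 'I_m]) P i,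
      (forall i, region (P i)),
      (forall i j, i != j -> P i `&` P j `<=` boundary (P i) `&` boundary (P j))
    & (forall i, leb_null (boundary (P i)))] /\
  [/\ (forall i x, P i x -> Omega (x + v i)),
      (forall x, Omega x -> P (idx x) x)
    & (forall i, leb_measurable [set x | Omega x /\ idx x = i])].

Definition pt_map (m : nat) (v : 'I_m -> vec) (idx : vec -> 'I_m) (x : vec) : vec :=
  x + v (idx x).

Fixpoint omega_n (m : nat) (Omega : set vec) (v : 'I_m -> vec)
    (idx : vec -> 'I_m) (n : nat) : set vec :=
  match n with
  | 0 => Omega
  | n'.+1 => closure (pt_map v idx @` omega_n Omega v idx n')
  end.

Definition attractor (m : nat) (Omega : set vec) (v : 'I_m -> vec)
    (idx : vec -> 'I_m) : set vec :=
  \bigcap_(n in [set: nat]) omega_n Omega v idx n.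

Definition lat_gen (v : 'I_d.+1 -> vec) (i : 'I_d) : vec :=
  v (lift ord0 i) - v ord0.

Definition in_lattice (v : 'I_d.+1 -> vec) (x : vec) : Prop :=
  exists k : 'I_d -> int, x = \sum_(i < d) (k i)%:~R *: lat_gen v i.

(* ergodicity of R(phi) = phi + pi(v_0) on T = R^d / L, expressed on L-periodic
   subsets of R^d (= preimages under pi of subsets of T) *)
Definition rotation_ergodic (v : 'I_d.+1 -> vec) : Prop :=
  forall B : set vec, leb_measurable B ->
    (forall x l, in_lattice v l -> (B (x + l) <-> B x)) ->
    (forall x, B (x + v ord0) <-> B x) ->
    leb_null B \/ leb_null (~` B).

(* pi^{-1}(pi x) ∩ A *)
Definition fiber_in (v : 'I_d.+1 -> vec) (A : set vec) (x : vec) : set vec :=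
  [set y | A y /\ in_lattice v (y - x)].

End Defs.

(* Main.v *)
Require Import Defs.
From HB Require Import structures.
From mathcomp Require Import all_boot all_order all_algebra.
From mathcomp Require Import all_classical all_reals all_analysis.
From mathcomp Require Import zify lra.
Import Order.TTheory GRing.Theory Num.Theory.
Import numFieldNormedType.Exports.
Local Open Scope card_scope.
Local Open Scope classical_set_scope.
Local Open Scope ring_scope.
Set Implicit Arguments. Unset Strict Implicit. Unset Printing Implicit Defensive.

(** Since all v_i are congruent modulo the lattice, F maps the fiber of A over
    R^{-1}(phi) into the fiber over phi.  A pigeonhole argument on the decreasing
    sets Omega_n shows that A is contained in the union of the (A ∩ P_i) + v_i,
    so F maps A onto A up to the null set of the translated boundaries.  Hence
    xi(phi) <= xi(R^{-1}(phi)) for almost every phi, and each set {xi >= k} is,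
    up to a null set, contained in its image under the rotation.  Its images
    increase to an invariant set, to which ergodicity applies, and nothing is
    gained in the limit because the rotation has no wandering set of positive
    measure.  So every {xi >= k} is null or conull; as A is bounded, xi is finite,
    and it is almost everywhere equal to the last k for which {xi >= k} is
    conull. *)

(** * The outer measure *)

Section LebesgueOuterMeasure.
Variables (R : realType) (d : nat).
Notation vec := 'rV[R]_d.
Implicit Types (E : set vec) (w : vec) (b : option (vec * vec)).

Lemma cvol_ge0 b : 0 <= cvol b.
Proof.
by case: b => [[lo hi]|]//=; apply: prodr_ge0 => i _; rewrite le_max lexx.
Qed.

Lemma leb_outer_ge0 E : (0 <= leb_outer E)%E.
Proof.
apply: le_ereal_inf_tmp => _ [c [_ ->]]; apply: nneseries_ge0 => n _ _.
by rewrite lee_fin cvol_ge0.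
Qed.

Lemma leb_outer_cover E (c : nat -> option (vec * vec)) :
  E `<=` \bigcup_k cbox (c k) ->
  (leb_outer E <= \sum_(0 <= k <oo) (cvol (c k))%:E)%E.
Proof. by move=> Ec; apply: ereal_inf_lbound; exists c. Qed.

Lemma leb_outer0 : leb_outer (set0 : set vec) = 0%E.
Proof.
apply/eqP; rewrite eq_le leb_outer_ge0 andbT.
rewrite (le_trans (@leb_outer_cover _ (fun=> None) _))// eseries0//.
Qed.

Lemma le_leb_outer : {homo @leb_outer R d : A B / A `<=` B >-> (A <= B)%E}.
Proof.
move=> A B AB; apply: ereal_inf_le_tmp => _ [c [Bc ->]].
by exists c; split => //; exact: subset_trans Bc.
Qed.

Lemma leb_outer_box (lo hi : vec) :
  (leb_outer (box lo hi) <= (box_vol lo hi)%:E)%E.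
Proof.
pose c (k : nat) : option (vec * vec) :=
  if k is 0%N then Some (lo, hi) else None.
rewrite (le_trans (@leb_outer_cover _ c _))//; first by move=> x bx; exists 0%N.
rewrite nneseries_recl//; last by move=> k _; rewrite lee_fin cvol_ge0.
by rewrite eseries_cond/= eseries0 ?adde0// => -[|k].
Qed.

(** When all outer measures are finite, near-optimal covers of the [A n], with errors e / 2 ^ (n +
    1), are merged into one cover of the union. *)
Lemma leb_outer_sigma_subadditive : sigma_subadditive (@leb_outer R d).
Proof.
move=> A; have [[i ioo]|] := pselect (exists i, leb_outer (A i) = +oo%E).
  rewrite (eseries_pinfty _ _ ioo) ?leey// => n _.
  by rewrite -ltNye (lt_le_trans _ (leb_outer_ge0 _)).
rewrite -forallNE => Aoo.
suff add2e (e : {posnum R}) :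
    (leb_outer (\bigcup_n A n) <= \sum_(i <oo) leb_outer (A i) + e%:num%:E)%E.
  by apply/lee_addgt0Pr => _/posnumP[].
rewrite (le_trans _ (epsilon_trick _ _ _))//; last first.
  by move=> n; exact: leb_outer_ge0.
pose P n (c : nat -> option (vec * vec)) := A n `<=` \bigcup_k cbox (c k) /\
  (\sum_(k <oo) (cvol (c k))%:E <=
   leb_outer (A n) + (e%:num / (2 ^ n.+1)%:R)%:E)%E.
have [G PG] : {G : nat -> nat -> option (vec * vec) & forall n, P n (G n)}.
  apply: (@choice _ _ P) => n.
  have en1 : 0 < e%:num / (2 ^ n.+1)%:R :> R by [].
  have /(lb_ereal_inf_adherent en1) : leb_outer (A n) \is a fin_num.
    rewrite ge0_fin_numE ?leb_outer_ge0// ltey; apply/eqP; exact: Aoo.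
  by move=> [_ [c [Ac ->]] /ltW le_c]; exists c.
pose vol (p : nat * nat) := (cvol (G p.1 p.2))%:E.
have vol_ge0 p : (0 <= vol p)%E by rewrite lee_fin cvol_ge0.
apply: (@le_trans _ _ (\esum_(p in [set: nat * nat]) vol p)%E).
  (* A bijection of nat with nat * nat lists the doubly indexed boxes as a single sequence. *)
  have /card_esym/ppcard_eqP[f] := card_nat2.
  rewrite (le_trans (@leb_outer_cover _ (fun k => G (f k).1 (f k).2) _))//.
    move=> t [i _ /(PG i).1[j _ Gij]]; exists (f^-1%FUN (i, j)) => //=.
    by rewrite invK ?inE.
  rewrite nneseries_esumT; last by move=> k; exact: (vol_ge0 (f k)).
  by rewrite (reindex_esum [set: nat] setT f).
rewrite (_ : [set: nat * nat] = setT `*`` (fun=> setT)); last first.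
  by apply/seteqP; split => -[].
rewrite -(@esum_esum _ _ _ _ _ (fun i j => vol (i, j)))//.
rewrite nneseries_esumT; last first.
  by move=> n; rewrite adde_ge0 ?leb_outer_ge0.
apply: le_esum => i _; rewrite -nneseries_esumT; last by move=> j.
exact: (PG i).2.
Qed.

(** This gives access to the Carathéodory theory: closure properties of measurable sets and
    additivity on disjoint families. *)
HB.instance Definition _ := isOuterMeasure.Build R vec (@leb_outer R d)
  leb_outer0 leb_outer_ge0 le_leb_outer leb_outer_sigma_subadditive.

Lemma leb_null_le E : (leb_outer E <= 0)%E -> leb_null E.
Proof. by move=> E0; apply/eqP; rewrite eq_le E0 leb_outer_ge0. Qed.

Lemma leb_null_sub (E E' : set vec) : E `<=` E' -> leb_null E' -> leb_null E.
Proof.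
by move=> EE' E'0; apply: leb_null_le; rewrite -E'0; exact: le_leb_outer.
Qed.

Lemma leb_null_bigcup (E : nat -> set vec) :
  (forall n, leb_null (E n)) -> leb_null (\bigcup_n E n).
Proof.
move=> E0; apply: leb_null_le; apply: (le_trans (leb_outer_sigma_subadditive _)).
by rewrite eseries0// => n _ _; exact: E0.
Qed.

(** An arbitrary countable index type is allowed because the later indices are integers paired with
    lattice coordinates. Codes that [unpickle] to nothing contribute the empty set. *)
Lemma leb_null_exists (T : countType) (E : T -> set vec) :
  (forall t, leb_null (E t)) -> leb_null [set x | exists t, E t x].
Proof.
move=> E0.
apply: (@leb_null_sub _ (\bigcup_n if unpickle n is Some t then E t else set0)).
  by move=> x [t Etx]; exists (pickle t) => //; rewrite pickleK.
by apply: leb_null_bigcup => n; case: unpickle => [t|]; [exact: E0|exact: leb_outer0].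
Qed.

Lemma leb_nullU (E E' : set vec) :
  leb_null E -> leb_null E' -> leb_null (E `|` E').
Proof.
move=> E0 E'0; apply: leb_null_le.
by rewrite (le_trans (outer_measureU2 _ _ _))//= E0 E'0 adde0.
Qed.

Lemma leb_measurable_null E : leb_null E -> leb_measurable E.
Proof.
move=> E0; apply: le_caratheodory_measurable => X /=.
rewrite [X in (X + _)%E](_ : _ = 0%E) ?add0e; first exact: le_leb_outer.
by apply: leb_null_sub E0.
Qed.

Lemma leb_measurableC E : leb_measurable E -> leb_measurable (~` E).
Proof. exact: (@caratheodory_measurable_setC _ _ (@leb_outer R d)). Qed.

Lemma leb_measurableI (E E' : set vec) :
  leb_measurable E -> leb_measurable E' -> leb_measurable (E `&` E').
Proof. exact: (@caratheodory_measurable_setI _ _ (@leb_outer R d)). Qed.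

Lemma leb_measurableD (E E' : set vec) :
  leb_measurable E -> leb_measurable E' -> leb_measurable (E `\` E').
Proof. exact: (@caratheodory_measurable_setD _ _ (@leb_outer R d)). Qed.

Lemma leb_measurable_exists (T : countType) (E : T -> set vec) :
  (forall t, leb_measurable (E t)) -> leb_measurable [set x | exists t, E t x].
Proof.
move=> mE.
rewrite (_ : [set x | _] =
  \bigcup_n if unpickle n is Some t then E t else set0); last first.
  apply/seteqP; split => x.
    by move=> [t Etx]; exists (pickle t) => //; rewrite pickleK.
  by move=> [n _]; case: unpickle => // t Etx; exists t.
apply: (@caratheodory_measurable_bigcup _ _ (@leb_outer R d)) => n.
by case: unpickle => [t|]; [exact: mE|exact: caratheodory_measurable_set0].
Qed.

Lemma leb_measurable_forall (T : countType) (E : T -> set vec) :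
  (forall t, leb_measurable (E t)) -> leb_measurable [set x | forall t, E t x].
Proof.
move=> mE; rewrite (_ : [set x | _] = ~` [set x | exists t, (~` E t) x]).
  by apply/leb_measurableC/leb_measurable_exists => t; exact/leb_measurableC/mE.
apply/seteqP; split => x /=; first by move=> Ex [t]; apply.
by move=> /forallNP Ex t; exact: contrapT (Ex t).
Qed.

Lemma box_shift (lo hi w x : vec) :
  box (lo - w) (hi - w) x <-> box lo hi (x + w).
Proof.
by split=> bx i; have := bx i; rewrite !mxE lerBlDr lerBrDr.
Qed.

Lemma leb_outer_shift_le E w :
  (leb_outer [set x | E (x + w)%R] <= leb_outer E)%E.
Proof.
apply: le_ereal_inf_tmp => _ [c [Ec ->]].
pose c' k := if c k is Some (lo, hi) then Some (lo - w, hi - w) else None.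
rewrite (le_trans (@leb_outer_cover _ c' _))//.
  move=> x /= /Ec[k _ ck]; exists k => //.
  by rewrite /c'; case: (c k) ck => [[lo hi]|]//= /box_shift.
apply: lee_nneseries => k _; first by rewrite lee_fin cvol_ge0.
rewrite lee_fin /c'; case: (c k) => [[lo hi]|]//=.
rewrite le_eqVlt; apply/orP; left; apply/eqP; apply: eq_bigr => i _.
by rewrite !mxE opprD opprK addrACA addNr addr0.
Qed.

Lemma leb_outer_shift E w : leb_outer [set x | E (x + w)] = leb_outer E.
Proof.
apply/eqP; rewrite eq_le leb_outer_shift_le/=.
apply: le_trans (leb_outer_shift_le _ (- w)).
by apply: le_leb_outer => x /=; rewrite subrK.
Qed.

Lemma leb_null_shift E w : leb_null E -> leb_null [set x | E (x + w)].
Proof. by rewrite /leb_null leb_outer_shift. Qed.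

(** Splitting a test set by the shifted set amounts, after translating both, to splitting the
    translated test set by [E]. *)
Lemma leb_measurable_shift E w :
  leb_measurable E -> leb_measurable [set x | E (x + w)].
Proof.
have shift Y : leb_outer Y = leb_outer [set x | Y (x - w)].
  by rewrite leb_outer_shift.
move=> mE X; rewrite (shift X) mE (shift (X `&` _)) (shift (X `&` ~` _)).
by congr (_ + _); congr leb_outer; apply/seteqP; split => x /=; rewrite subrK.
Qed.

End LebesgueOuterMeasure.

(** * Measurability of closed sets *)

Section BorelSets.
Variables (R : realType) (d : nat).
Notation vec := 'rV[R]_d.
Implicit Types (E : set vec) (w : vec) (b : option (vec * vec)).

(** The hyperplane x_i = a cuts a box into [cut_le] and [cut_ge]. If it misses the box, one piece
    has its bounds in direction i reversed, hence is empty, and the maximum with 0 in [box_vol]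
    gives it volume 0. *)
Let cut_le (i : 'I_d) (a : R) b : option (vec * vec) :=
  if b is Some (lo, hi) then
    Some (lo, \row_j if j == i then Num.min (hi 0 j) a else hi 0 j)
  else None.

Let cut_ge (i : 'I_d) (a : R) b : option (vec * vec) :=
  if b is Some (lo, hi) then
    Some (\row_j if j == i then Num.max (lo 0 j) a else lo 0 j, hi)
  else None.

Let cut_le_vol_ge i a b : cvol (cut_le i a b) + cvol (cut_ge i a b) <= cvol b.
Proof.
case: b => [[lo hi]|] /=; last by rewrite addr0.
rewrite /box_vol (bigD1 i)//= [X in _ + X](bigD1 i)//= [leRHS](bigD1 i)//=.
rewrite !mxE eqxx.
under eq_bigr => j ji do rewrite !mxE (negbTE ji).
under [X in _ + _ * X]eq_bigr => j ji do rewrite !mxE (negbTE ji).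
rewrite -mulrDl; apply: ler_wpM2r.
  by apply: prodr_ge0 => j _; rewrite le_max lexx.
rewrite /Num.max /Num.min.
by repeat case: ifP => /=; lra.
Qed.

(** Cutting every box of a cover of X along the hyperplane yields covers of both parts of X without
    increasing the total volume. *)
Lemma leb_measurable_halfspace (i : 'I_d) (a : R) :
  leb_measurable [set x : vec | x 0 i <= a].
Proof.
apply: le_caratheodory_measurable => X /=.
apply: le_ereal_inf_tmp => _ [c [Xc ->]].
apply: (@le_trans _ _ (\sum_(0 <= k <oo) (cvol (cut_le i a (c k)))%:E +
   \sum_(0 <= k <oo) (cvol (cut_ge i a (c k)))%:E)%E).
  apply: leeD; apply: leb_outer_cover => x /= [/Xc[k _ ck]].
  - move=> xa; exists k => //; case: (c k) ck => [[lo hi]|]//= bx j.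
    rewrite mxE; case: eqP => [->|_]; last exact: bx.
    by rewrite le_min xa andbT; exact: bx.
  - move=> /negP; rewrite -ltNge => /ltW xa.
    exists k => //; case: (c k) ck => [[lo hi]|]//= bx j.
    rewrite mxE; case: eqP => [->|_]; last exact: bx.
    by rewrite ge_max xa andbT; exact: bx.
rewrite -nneseriesD; try by move=> k _; rewrite lee_fin cvol_ge0.
apply: lee_nneseries => k _; last by rewrite -EFinD lee_fin cut_le_vol_ge.
by rewrite -EFinD lee_fin addr_ge0 ?cvol_ge0.
Qed.

(** Half-open, so that each coordinate condition is a difference of two of the half-spaces above. *)
Definition cell (lo hi : 'I_d -> R) : set vec :=
  [set x | forall i, lo i < x 0 i <= hi i].

Lemma leb_measurable_cell (lo hi : 'I_d -> R) : leb_measurable (cell lo hi).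
Proof.
apply: leb_measurable_forall => i.
rewrite [X in leb_measurable X](_ : _ =
  [set x : vec | x 0 i <= hi i] `\` [set x : vec | x 0 i <= lo i]).
  by apply: leb_measurableD; exact: leb_measurable_halfspace.
apply/seteqP; split => x /=.
  by move=> /andP[lx xh]; split => //; apply/negP; rewrite -ltNge.
by move=> [xh /negP]; rewrite -ltNge => ->.
Qed.

(** An open set is the union of the countably many cells with rational corners that it contains. *)
Lemma leb_measurable_open (U : set vec) : open U -> leb_measurable U.
Proof.
move=> oU; pose Q := {ffun 'I_d -> rat}.
pose rcell (q : Q * Q) : set vec :=
  cell (fun i => ratr (q.1 i)) (fun i => ratr (q.2 i)).
rewrite (_ : U = [set x | exists q : Q * Q,
    (if `[< rcell q `<=` U >] then rcell q else set0) x]).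
  apply: leb_measurable_exists => q; case: asboolP => _.
    exact: leb_measurable_cell.
  exact: leb_measurable_null (leb_outer0 _ _).
apply/seteqP; split => x /=; last first.
  by move=> [q]; case: asboolP => // qU qx; exact: qU.
move=> Ux; have /nbhs_ballP[e /= e0 eU] : nbhs x U by exact: open_nbhs_nbhs.
(* Balls are cubes for the sup norm, so rational corners chosen coordinate by coordinate within e of
   x bound a cell around x inside the ball. *)
have [lo lox] : {lo : 'I_d -> rat & forall i, x 0 i - e < ratr (lo i) < x 0 i}.
  apply: (@choice _ _ (fun i (q : rat) => x 0 i - e < ratr q < x 0 i)) => i.
  have /rat_in_itvoo[q] : x 0 i - e < x 0 i by rewrite ltrBlDr ltrDl.
  by rewrite in_itv/=; exists q.
have [hi hix] : {hi : 'I_d -> rat & forall i, x 0 i < ratr (hi i) < x 0 i + e}.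
  apply: (@choice _ _ (fun i (q : rat) => x 0 i < ratr q < x 0 i + e)) => i.
  have /rat_in_itvoo[q] : x 0 i < x 0 i + e by rewrite ltrDl.
  by rewrite in_itv/=; exists q.
exists ([ffun i => lo i], [ffun i => hi i]); case: asboolP; last first.
  case=> y qy; apply: eU; split => // j i; rewrite (ord1 j).
  have := qy i; rewrite /= !ffunE; have := lox i; have := hix i.
  move=> /andP[_ h2] /andP[l1 _] /andP[l h]; rewrite /ball/= ltr_distlC.
  by apply/andP; split; lra.
move=> _ i; rewrite /= !ffunE; have := lox i; have := hix i.
by move=> /andP[/ltW-> _] /andP[_ ->].
Qed.

Lemma leb_measurable_closed (K : set vec) : closed K -> leb_measurable K.
Proof.
by move=> /closed_openC/leb_measurable_open/leb_measurableC; rewrite setCK.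
Qed.

End BorelSets.

(** * The translation lattice *)

Section Lattice.
Variables (R : realType) (d : nat) (v : 'I_d.+1 -> 'rV[R]_d).
Notation vec := 'rV[R]_d.
Let G : 'M[R]_d := \matrix_(i < d) lat_gen v i.

(** Finite functions to the integers form a countable type, so quantifying over the lattice gives
    countable unions. *)
Definition lattice_point (z : {ffun 'I_d -> int}) : vec :=
  (\row_i (z i)%:~R) *m G.

Lemma in_latticeP l : in_lattice v l <-> exists z, l = lattice_point z.
Proof.
have latE (k : 'I_d -> int) :
    \sum_(i < d) (k i)%:~R *: lat_gen v i = (\row_i (k i)%:~R) *m G.
  rewrite mulmx_sum_row; apply: eq_bigr => i _; rewrite mxE.
  by rewrite rowK.
split=> [[k ->]|[z ->]]; last by exists z; rewrite latE.
by exists [ffun i => k i]; rewrite latE; congr (_ *m _); apply/rowP => i;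
  rewrite !mxE ffunE.
Qed.

Lemma in_lattice0 : in_lattice v 0.
Proof. by exists (fun=> 0); rewrite big1// => i _; rewrite mulr0z scale0r. Qed.

Lemma in_latticeB l l' :
  in_lattice v l -> in_lattice v l' -> in_lattice v (l - l').
Proof.
move=> [k ->] [k' ->]; exists (fun i => k i - k' i); rewrite -sumrB.
by apply: eq_bigr => i _; rewrite intrB scalerBl.
Qed.

Lemma in_latticeN l : in_lattice v l -> in_lattice v (- l).
Proof. by rewrite -sub0r; exact: in_latticeB in_lattice0. Qed.

Lemma in_latticeD l l' :
  in_lattice v l -> in_lattice v l' -> in_lattice v (l + l').
Proof. by move=> ll ll'; rewrite -(opprK l'); exact/in_latticeB/in_latticeN. Qed.

Lemma in_lattice_gen (i : 'I_d.+1) : in_lattice v (v i - v ord0).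
Proof.
case: (unliftP ord0 i) => [j ->|->]; last by rewrite subrr; exact: in_lattice0.
exists (fun k => (k == j)%:R); rewrite (bigD1 j)//= eqxx scale1r big1 ?addr0//.
by move=> k /negbTE->; rewrite scale0r.
Qed.

Hypothesis Gfree : row_free G.

Let Gunit : G \in unitmx. Proof. by rewrite -row_free_unit. Qed.

Lemma lattice_point_inj : injective lattice_point.
Proof.
move=> z z' /(congr1 (mulmx^~ (invmx G))); rewrite /lattice_point !mulmxK//.
by move=> zz'; apply/ffunP => i; have := congr1 (fun x : vec => x 0 i) zz';
  rewrite !mxE => /intr_inj.
Qed.

(** Reduction to the fundamental parallelepiped: taking fractional parts of the coordinates of w in
    the basis [G] leaves a combination of its rows with coefficients in [0, 1). *)
Lemma lattice_reduction : exists M : R, forall w : vec,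
  exists2 l, in_lattice v l & forall i, `|(w + l) 0 i| <= M.
Proof.
exists (\sum_i \sum_j `|G i j|) => w.
pose f := w *m invmx G; pose z := [ffun i => - Num.floor (f 0 i)].
exists (lattice_point z); first by apply/in_latticeP; exists z.
move=> j; have -> : w + lattice_point z =
    (\row_i (f 0 i - (Num.floor (f 0 i))%:~R)) *m G.
  rewrite -[w in LHS](mulmxKV Gunit) -mulmxDl; congr (_ *m _).
  by apply/rowP => i; rewrite [LHS]mxE [RHS]mxE [X in _ + X = _]mxE ffunE intrN.
rewrite mxE (le_trans (ler_norm_sum _ _ _))//; apply: ler_sum => i _.
rewrite mxE normrM [leRHS](bigD1 j)//= -[leLHS]addr0 lerD ?sumr_ge0//.
rewrite ler_piMl//; have /andP[f0 f1] := floor_itv (f 0 i).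
by rewrite ger0_norm ?subr_ge0// lerBlDr addrC -(intrD1) ltW.
Qed.

(** Multiplying by the inverse of [G] recovers the integer coordinates, which are therefore bounded
    too. *)
Lemma finite_lattice_bounded (M : R) : finite_set
  [set l | in_lattice v l /\ forall i, `|l 0 i| <= M].
Proof.
pose C := `|M| * \sum_i \sum_j `|invmx G i j|.
(* The coordinates lie in [-n, n]; adding n places them among the 2n + 1 elements of
   ['I_(n.+1 + n)]. *)
pose n := Num.truncn C; pose T := {ffun 'I_d -> 'I_(n.+1 + n)}.
pose pt (t : T) : vec := lattice_point [ffun i => (t i)%:Z - n%:Z].
apply: (@sub_finite_set _ _ (pt @` [set: T])); last first.
  by apply: finite_image; exact: finite_finset.
move=> l [/in_latticeP[z ->] zM].
have zn i : `|z i| <= n%:Z.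
  rewrite -ltzD1 -PoszD addn1 -(ltr_int R) intr_norm.
  have : (\row_i (z i)%:~R) 0 i = (lattice_point z *m invmx G) 0 i :> R.
    by rewrite mulmxK.
  rewrite mxE => ->; apply: le_lt_trans (truncnS_gt C).
  rewrite mxE (le_trans (ler_norm_sum _ _ _))// /C mulr_sumr; apply: ler_sum.
  move=> j _; rewrite normrM; apply: ler_pM => //.
    exact: le_trans (zM j) (ler_norm _).
  by rewrite (bigD1 i)//= lerDl sumr_ge0.
have zlt i : (absz (z i + n%:Z)%R < n.+1 + n)%N.
  have := zn i; lia.
exists [ffun i => Ordinal (zlt i)] => //.
rewrite /pt; congr lattice_point; apply/ffunP => i; rewrite !ffunE /=.
by have := zn i; lia.
Qed.

(* Modulo the lattice, n w can be kept bounded, so infinitely many disjoint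
   translates of each bounded piece of W fit into one box of finite volume. *)
Lemma wandering_null (W : set vec) w :
  leb_measurable W ->
  (forall x l, in_lattice v l -> W x -> W (x + l)) ->
  (forall x n m, W (x + w *+ n) -> W (x + w *+ m) -> n = m) ->
  leb_null W.
Proof.
move=> mW perW disjW.
pose Wr (r : nat) := W `&` cell (fun=> - r%:R) (fun=> r%:R).
suff Wr0 r : leb_null (Wr r).
  apply: leb_null_sub (leb_null_bigcup Wr0) => x Wx.
  exists (Num.truncn (\sum_i `|x 0 i|)).+1 => //; split => // i.
  have : `|x 0 i| < (Num.truncn (\sum_i `|x 0 i|)).+1%:R.
    apply: le_lt_trans (truncnS_gt _).
    by rewrite (bigD1 i)//= lerDl sumr_ge0.
  by rewrite ltr_norml => /andP[-> /ltW->].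
have [M redM] := lattice_reduction.
have [l ll lM] : exists2 l : nat -> vec, (forall n, in_lattice v (l n)) &
    forall n i, `|(w *+ n + l n) 0 i| <= M.
  have /choice[l lP] n : exists l, in_lattice v l /\
      forall i, `|(w *+ n + l) 0 i| <= M.
    by have [l ? ?] := redM (w *+ n); exists l.
  by exists l => n; have [] := lP n.
pose S n := [set x | Wr r (x + (w *+ n + l n))].
have mS n : leb_measurable (S n).
  by apply/leb_measurable_shift/leb_measurableI => //; exact: leb_measurable_cell.
have tS : trivIset setT S.
  move=> n m _ _ [x [[Wn _] [Wm _]]]; apply: (disjW x).
    by have := perW _ _ (in_latticeN (ll n)) Wn; rewrite addrA addrK.
  by have := perW _ _ (in_latticeN (ll m)) Wm; rewrite addrA addrK.
pose K : set vec := box (\row__ - (r%:R + M)) (\row__ (r%:R + M)).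
pose V := box_vol (\row__ - (r%:R + M) : vec) (\row__ (r%:R + M)).
have SK n : S n `<=` K.
  move=> x [_ cx] i; rewrite !mxE; have := cx i; have := lM n i.
  rewrite !mxE ler_norml => /andP[l1 l2] /andP[c1 c2].
  by apply/andP; split; lra.
have KV N : (\sum_(i < N) leb_outer (Wr r) <= V%:E)%E.
  apply: le_trans (leb_outer_box _ _); rewrite -/K.
  rewrite (eq_bigr (fun i : 'I_N => leb_outer (K `&` S i))); last first.
    by move=> i _; rewrite (setIidr (@SK _)) leb_outer_shift.
  rewrite -(@caratheodory_additive _ _ (@leb_outer R d))//.
  exact: le_leb_outer.
(* [KV] holds for every number of copies: one copy excludes an infinite value, and more than V / a
   copies exclude a positive value a. *)
move: KV; have := leb_outer_ge0 (Wr r); rewrite /leb_null.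
case: (leb_outer (Wr r)) => [a| |] // a0 KV; last first.
  by have := KV 1%N; rewrite big_ord1.
congr (_%:E); apply/eqP; rewrite eq_le; apply/andP; split => //.
rewrite leNgt; apply/negP => {}a0.
have := KV (Num.truncn (V / a)).+1; rewrite sumEFin lee_fin sumr_const card_ord.
apply/negP; rewrite -ltNge -mulr_natl -ltr_pdivrMr//.
exact: truncnS_gt.
Qed.

End Lattice.

(** * The attractor and its fibers *)

Section Attractor.
Variables (R : realType) (d m : nat) (Omega : set 'rV[R]_d).
Variables (P : 'I_m -> set 'rV[R]_d) (v : 'I_m -> 'rV[R]_d).
Variable (idx : 'rV[R]_d -> 'I_m).
Notation vec := 'rV[R]_d.
Hypothesis PT : piecewise_translation Omega P v idx.
Let F := pt_map v idx.
Let A := attractor Omega v idx.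

Let region_closed (K : set vec) : region K -> closed K.
Proof. by move=> [_ <-]; exact: closed_closure. Qed.

Let closed_shift (K : set vec) (w : vec) : closed K -> closed [set y | K (y - w)].
Proof.
apply: (@preimage_closed _ _ (fun y : vec => y - w)) => y _.
apply: (@cvgB _ vec _ _ (nbhs_filter y) (fun y : vec => y) (fun=> w)).
  exact: cvg_id.
exact: cvg_cst.
Qed.

Let closure_sub (K E : set vec) : closed K -> E `<=` K -> closure E `<=` K.
Proof. by move=> cK EK x /(closureS EK)/cK. Qed.

Lemma omega_n_closed n : closed (omega_n Omega v idx n).
Proof.
case: n => [|n]; last exact: closed_closure.
by have [[rO _ _ _ _] _] := PT; exact: region_closed.
Qed.

Lemma omega_n_decr n : omega_n Omega v idx n.+1 `<=` omega_n Omega v idx n.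
Proof.
have [[rO _ _ _ _] [Pv idxP _]] := PT.
elim: n => [|n IH] /=; last first.
  by apply: closureS => _ [x /IH Ox <-]; exists x.
apply: closure_sub; first exact: region_closed.
by move=> _ [x Ox <-]; exact/Pv/idxP.
Qed.

Lemma omega_n_antitone (n n' : nat) : (n <= n')%N ->
  omega_n Omega v idx n' `<=` omega_n Omega v idx n.
Proof.
elim: n' => [|n' IH]; first by rewrite leqn0 => /eqP->.
rewrite leq_eqVlt => /orP[/eqP->//|]; rewrite ltnS => /IH sub.
by move=> x /omega_n_decr/sub.
Qed.

Lemma attractor_closed : closed A.
Proof. by apply: closed_bigI => n _; exact: omega_n_closed. Qed.

Lemma attractor_sub : A `<=` Omega.
Proof. by move=> x /(_ 0%N); exact. Qed.

Lemma attractor_bounded : exists M : R, forall x i, A x -> `|x 0 i| <= M.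
Proof.
have [[[cO _] _ _ _ _] _] := PT.
have [M [_ OM]] := compact_bounded cO; exists (M + 1) => x i /attractor_sub Ox.
have := OM (M + 1); rewrite ltrDl ltr01 => /(_ isT _ Ox).
apply: le_trans; rewrite [leRHS]/Num.norm/= mx_normrE.
exact: (@le_bigmax _ _ _ _ (fun ij => `|x ij.1 ij.2|) (0, i)).
Qed.

Lemma pt_map_attractor x : A x -> A (F x).
Proof.
move=> Ax [_|n _]; last by apply: subset_closure; exists x => //; exact: Ax.
have [_ [Pv idxP _]] := PT.
by apply/Pv/idxP; exact: attractor_sub.
Qed.

(** Here the branch is recorded by membership in the closed [P i], not by [idx], so that the
    condition survives the closures in [omega_n]. *)
Lemma attractor_preimage y : A y -> exists i, A (y - v i) /\ P i (y - v i).
Proof.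
have [[_ _ rP _ _] [Pv idxP _]] := PT => Ay.
pose S n i := omega_n Omega v idx n (y - v i) /\ P i (y - v i).
have OS n : exists i, S n i.
  have : omega_n Omega v idx n.+1 y by exact: Ay.
  (* A finite union of closed sets containing the image of the n-th set under F, hence also the
     closure of that image. *)
  pose U := \bigcup_(i in [set: 'I_m])
    ([set z | omega_n Omega v idx n (z - v i)] `&` [set z | P i (z - v i)]).
  suff : closure (F @` omega_n Omega v idx n) `<=` U.
    by move=> /[apply] -[i _ Si]; exists i.
  have cU : closed U.
    apply: closed_bigcup; first exact: finite_finset.
    move=> i _; apply: closedI; apply: closed_shift; first exact: omega_n_closed.
    exact: region_closed.
  apply: closure_sub => // _ [x Ox <-].
  exists (idx x) => //=; rewrite /F /pt_map addrK; split => //.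
  by apply: idxP; apply: (omega_n_antitone (leq0n n)).
apply: contrapT => /forallNP noi.
(* If every branch i failed at some stage [N i], then, the sets being decreasing, all would fail at
   the largest of these stages. *)
have /choice[N SN] i : exists n, ~ S n i.
  apply: contrapT => /forallNP Si; apply: (noi i); split; last first.
    by have /contrapT[] := Si 0%N.
  by move=> n _; have /contrapT[] := Si n.
have [i [Oi Pi]] := OS (\max_i N i); apply: (SN i); split => //.
by apply: omega_n_antitone Oi; exact: leq_bigmax.
Qed.

Lemma idx_interior i x : P i x -> ~ boundary (P i) x -> idx x = i.
Proof.
have [[_ OE _ PP _] [_ idxP _]] := PT => Px nbx.
have Ox : Omega x by rewrite OE; exists i.
apply: contrapT => /eqP ne; apply: nbx.
by have [] := PP (idx x) i ne x (conj (idxP x Ox) Px).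
Qed.

(** Off the translated boundaries, the branch found by [attractor_preimage] is the one that [idx]
    selects. *)
Lemma attractor_surj y : A y -> (forall i, ~ boundary (P i) (y - v i)) ->
  exists2 x, A x & F x = y.
Proof.
move=> /attractor_preimage[i [Ai Pi]] /(_ i) nb; exists (y - v i) => //.
by rewrite /F /pt_map (idx_interior Pi nb) subrK.
Qed.

End Attractor.

(** * Level sets of the number of points in a fiber *)

Section FiberCount.
Variables (R : realType) (d : nat) (Omega : set 'rV[R]_d).
Variables (P : 'I_d.+1 -> set 'rV[R]_d) (v : 'I_d.+1 -> 'rV[R]_d).
Variable (idx : 'rV[R]_d -> 'I_d.+1).
Notation vec := 'rV[R]_d.
Hypothesis PT : piecewise_translation Omega P v idx.
Hypothesis Gfree : row_free (\matrix_(i < d) lat_gen v i).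
Let A := attractor Omega v idx.
Let fiber := fiber_in v A.

(** The set {xi >= k}, written as a comparison of cardinals so that it makes sense before fibers are
    known to be finite. *)
Definition fiber_ge (k : nat) : set vec := [set x | `I_k #<= fiber x].

Lemma fiber_periodic x l : in_lattice v l -> fiber (x + l) = fiber x.
Proof.
move=> ll; apply/seteqP; split => y [Ay yx]; split => //.
  have -> : y - x = y - (x + l) + l by rewrite opprD addrA subrK.
  exact: in_latticeD.
by rewrite opprD addrA; exact: in_latticeB.
Qed.

(** Points of the fiber differ from x by lattice vectors whose size is bounded in terms of A and
    x. *)
Lemma fiber_finite x : finite_set (fiber x).
Proof.
have [M AM] := attractor_bounded PT.
have fin := finite_lattice_bounded Gfree (M + \sum_i `|x 0 i|).
apply: sub_finite_set (finite_image (fun l => l + x) fin).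
move=> y [Ay yx]; exists (y - x); last by rewrite subrK.
split => // i; rewrite !mxE (le_trans (ler_normB _ _))// lerD ?AM//.
by rewrite (bigD1 i)//= lerDl sumr_ge0.
Qed.

(** This exhibits {xi >= k} as a countable union, over injective tuples of lattice coordinates, of
    finite intersections of translates of A, whence its measurability. *)
Lemma fiber_geP k x : fiber_ge k x <->
  exists t : {ffun 'I_k -> {ffun 'I_d -> int}},
    injective t /\ forall j, A (x + lattice_point v (t j)).
Proof.
rewrite /fiber_ge /= (card_le_eql card_II).
split=> [/pcard_leP/injfunPex[g gx ginj]|[t [tinj At]]].
  have /choice[t tP] j : exists z, x + lattice_point v z = g j.
    have [_ /in_latticeP[z zE]] := gx j I.
    by exists z; rewrite -zE addrC subrK.
  exists [ffun j => t j]; split => [j j'|j]; rewrite !ffunE.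
    by move=> tjj'; apply: ginj; rewrite ?inE// -!tP tjj'.
  by rewrite tP; have [] := gx j I.
apply/pcard_leP/injfunPex; exists (fun j => x + lattice_point v (t j)).
  move=> j _; split; first exact: At.
  by rewrite addrAC subrr add0r; apply/in_latticeP; exists (t j).
by move=> j j' _ _ /addrI/(lattice_point_inj Gfree)/tinj.
Qed.

Lemma fiber_ge_measurable k : leb_measurable (fiber_ge k).
Proof.
rewrite (_ : fiber_ge k = [set x | exists t : {ffun 'I_k -> {ffun 'I_d -> int}},
  (if injectiveb t then [set x | forall j, A (x + lattice_point v (t j))] else set0) x]).
  apply: leb_measurable_exists => t; case: injectiveb; last first.
    exact: leb_measurable_null (leb_outer0 _ _).
  apply: leb_measurable_forall => j; apply: leb_measurable_shift.
  by apply: leb_measurable_closed; exact: attractor_closed PT.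
apply/seteqP; split => x.
  by move=> /fiber_geP[t [/injectiveP it At]]; exists t; rewrite it.
by move=> [t]; case: injectiveP => // it At; apply/fiber_geP; exists t.
Qed.

(* The boundaries translated by v_i, saturated under the lattice and under the
   rotation in both directions, so that the complement is invariant. *)
Definition singular : set vec :=
  [set x | exists n : int * {ffun 'I_d -> int} * 'I_d.+1,
    boundary (P n.2) (x + (v ord0 *~ n.1.1 + lattice_point v n.1.2 - v n.2))].

Lemma singular_null : leb_null singular.
Proof.
apply: leb_null_exists => -[[n z] i]; apply: leb_null_shift.
by have [[_ _ _ _ b0] _] := PT; exact: b0.
Qed.

Lemma singular_periodic x l : in_lattice v l -> singular (x + l) -> singular x.
Proof.
move=> /in_latticeP[z' ->] [[[n z] i] /= b].
have /in_latticeP[z'' z''E] : in_lattice v (lattice_point v z' + lattice_point v z).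
  by apply: in_latticeD; apply/in_latticeP; [exists z'|exists z].
exists (n, z'', i) => /=; congr (boundary _ _): b.
by rewrite -z''E -!addrA; congr (_ + _); rewrite addrCA.
Qed.

Lemma singular_shift x (n' : int) : singular (x + v ord0 *~ n') -> singular x.
Proof.
move=> [[[n z] i] /= b]; exists (n' + n, z, i) => /=.
by congr (boundary _ _): b; rewrite mulrzDr -!addrA.
Qed.

(* Off the singular set, F maps the fiber over x - v_0 onto the fiber over x. *)
Lemma fiber_ge_shift k x : fiber_ge k x -> ~ singular x -> fiber_ge k (x - v ord0).
Proof.
move=> kx nbx; apply: card_le_trans kx _.
apply: (@card_le_trans _ _ _ (pt_map v idx @` fiber (x - v ord0))); last first.
  exact: card_image_le.
apply: subset_card_le => y [Ay yx].
(* y is a lattice translate of x, so a boundary point at y - v_i would make x singular. *)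
have nby i : ~ boundary (P i) (y - v i).
  move=> b; apply: nbx; apply: (@singular_periodic x (y - x)) => //.
  have /in_latticeP[z zE] : in_lattice v 0 by exact: in_lattice0.
  by exists (0, z, i) => /=; rewrite mulr0z -zE !add0r [x + _]addrC subrK.
have [u Au Fu] := attractor_surj PT Ay nby; exists u => //; split => //.
(* F moves u by a vector congruent to v_0 modulo the lattice, so u lies over x - v_0. *)
rewrite (_ : _ - _ = (y - x) - (v (idx u) - v ord0)).
  by apply: in_latticeB => //; exact: in_lattice_gen.
by rewrite -Fu /pt_map !opprB (addrAC u) addrACA subrr addr0 -addrA (addrC (- x)).
Qed.

End FiberCount.

(** * A zero-one law for subinvariant sets *)

(* The translates of B by n v_0 increase to an invariant set C, and C \ B is a
   countable union of translates of the wandering set (B + v_0) \ B. *)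
Lemma ergodic_subinvariant (R : realType) (d : nat) (v : 'I_d.+1 -> 'rV[R]_d)
    (B : set 'rV[R]_d) :
  row_free (\matrix_(i < d) lat_gen v i) -> rotation_ergodic v ->
  leb_measurable B ->
  (forall x l, in_lattice v l -> B x -> B (x + l)) ->
  (forall x, B x -> B (x - v ord0)) ->
  leb_null B \/ leb_null (~` B).
Proof.
move=> Gfree erg mB perB subB.
have subBn x n : B x -> B (x - v ord0 *+ n).
  move=> Bx; elim: n => [|n IH]; first by rewrite subr0.
  by rewrite mulrSr opprD addrA; exact: subB.
pose C := [set x | exists n : nat, B (x - v ord0 *+ n)].
have mBn n : leb_measurable [set x | B (x - v ord0 *+ n)].
  exact: leb_measurable_shift.
have BC : B `<=` C by move=> x Bx; exists 0%N; rewrite subr0.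
have perC x l : in_lattice v l -> C (x + l) <-> C x.
  move=> ll; split=> -[n Bn]; exists n.
    by have := perB _ _ (in_latticeN ll) Bn; rewrite addrAC addrK.
  by rewrite addrAC; exact: perB.
have invC x : C (x + v ord0) <-> C x.
  split=> -[n Bn]; last first.
    by exists n.+1; rewrite mulrS opprD addrA addrK.
  by exists n; have := subB _ Bn; rewrite addrAC addrK.
have [C0|nC0] := erg C (leb_measurable_exists mBn) perC invC.
  by left; exact: leb_null_sub C0.
right; pose W := [set x | B (x - v ord0)] `\` B.
have W0 : leb_null W.
  apply: (@wandering_null _ _ v Gfree W (v ord0)).
  - by apply: leb_measurableD => //; exact: leb_measurable_shift.
  - move=> x l ll [Bx nBx]; split; first by rewrite /= addrAC; exact: perB.
    by move=> /(perB _ _ (in_latticeN ll)); rewrite addrK.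
  - move=> x; suff key n m : (n < m)%N -> W (x + v ord0 *+ n) -> ~ W (x + v ord0 *+ m).
      move=> n m Wn Wm; have [nm|nm|//] := ltngtP n m.
        by have := key _ _ nm Wn.
      by have := key _ _ nm Wm.
    (* From x + m v_0 in W follows x + (m - 1) v_0 in B; going back m - 1 - n more steps puts x + n
       v_0 in B. *)
    move=> nm [_ nBn] [Bm _]; apply: nBn; have := subBn _ (m - n.+1)%N Bm.
    rewrite -!addrA -opprD -mulrS subnSK// mulrnBr ?(ltnW nm)// opprB.
    by rewrite [_ *+ m + _]addrC subrK.
apply: (@leb_null_sub _ _ _ (~` C `|` [set x | exists n : nat, W (x - v ord0 *+ n)])).
  move=> x nBx; have [[n Bn]|] := pselect (C x); last by left.
  (* x is outside B, so at the first entry of its backward orbit into B, say at step n + 1, the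
     point x - n v_0 lies in W. *)
  right; elim: n Bn => [|n IH] Bn; first by rewrite subr0 in Bn.
  have [/IH//|nBn] := pselect (B (x - v ord0 *+ n)).
  by exists n; split => //=; rewrite -addrA -opprD -mulrSr.
apply: leb_nullU => //; apply: leb_null_exists => n.
exact: leb_null_shift.
Qed.

Theorem theorem2p2 (R : realType) (d : nat) (Omega : set 'rV[R]_d)
  (P : 'I_d.+1 -> set 'rV[R]_d) (v : 'I_d.+1 -> 'rV[R]_d)
  (idx : 'rV[R]_d -> 'I_d.+1) :
  piecewise_translation Omega P v idx ->
  row_free (\matrix_(i < d) lat_gen v i) ->
  rotation_ergodic v ->
  exists c : nat,
    leb_null [set x : 'rV[R]_d |
      ~ card_eq (fiber_in v (attractor Omega v idx) x) `I_c].
Proof.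
move=> PT Gfree erg; pose B k := fiber_ge Omega v idx k.
have B01 k : leb_null (B k) \/ leb_null (~` B k).
  have N0 := singular_null PT; set N := singular P v in N0.
  (* Deleting the null set N makes the inclusion under the rotation hold at every point, as
     [ergodic_subinvariant] requires. *)
  have mBN : leb_measurable (B k `\` N).
    apply: leb_measurableD; first exact: (fiber_ge_measurable PT Gfree).
    exact: leb_measurable_null.
  have perBN x l : in_lattice v l -> (B k `\` N) x -> (B k `\` N) (x + l).
    move=> ll [kx nbx]; split; first by rewrite /B /fiber_ge/= fiber_periodic.
    by move=> /(singular_periodic ll).
  have subBN x : (B k `\` N) x -> (B k `\` N) (x - v ord0).
    move=> [kx nbx]; split; first exact: (fiber_ge_shift PT kx nbx).
    by move=> bx; apply: nbx; apply: (@singular_shift _ _ P v x (-1)).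
  have [BN0|BN0] := ergodic_subinvariant Gfree erg mBN perBN subBN.
    left; apply: leb_null_sub (leb_nullU BN0 N0) => x kx.
    by have [|] := pselect (N x); [right|left].
  by right; apply: leb_null_sub BN0 => x nkx [].
have fiberc x : exists n, fiber_in v (attractor Omega v idx) x #= `I_n.
  exact/finite_setP/(fiber_finite PT Gfree).
(* If the whole space is null, any constant serves, here 0. Otherwise [nfull] shows below that some
   [B k] is null and that [B 0] is not. *)
have [full|nfull] := pselect (leb_null [set: 'rV[R]_d]).
  by exists 0%N; exact: leb_null_sub full.
(* Fibers are finite, so the complements of the [B k] cover the space and cannot all be null. *)
have [k Bk0] : exists k, leb_null (B k).
  apply: contrapT => /forallNP nB0; apply: nfull.
  apply: (@leb_null_sub _ _ _ (\bigcup_k ~` B k)); last first.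
    by apply: leb_null_bigcup => k; have [/nB0|] := B01 k.
  move=> x _; have [n xn] := fiberc x; exists n.+1 => //=.
  by rewrite /B /fiber_ge/= (card_le_eqr xn) card_le_II ltnn.
have exB : exists k, `[< leb_null (B k) >] by exists k; apply/asboolP.
(* The least index with [B] null is not 0, since [B 0] is the whole space; its predecessor c is the
   constant, as [B c] is conull by minimality. *)
case: (ex_minnP exB) => -[|c] /asboolP Bc0 minc.
  case: nfull; apply: leb_null_sub Bc0 => x _; have [n xn] := fiberc x.
  by rewrite /B /fiber_ge/= (card_le_eqr xn) card_le_II.
have [/asboolP/minc|nBc0] := B01 c; first by rewrite ltnn.
(* A fiber without exactly c points has more than c, so x is in [B c.+1], or fewer, so x is outside
   [B c]. *)
exists c; apply: leb_null_sub (leb_nullU Bc0 nBc0) => x /=.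
have [n xn] := fiberc x; rewrite (card_eql xn) => nc.
rewrite /B /fiber_ge /= !(card_le_eqr xn) !card_le_II.
have [cn|nlec] := ltnP c n; [by left|right].
apply/negP; rewrite -ltnNge ltn_neqAle nlec andbT; apply/eqP => /card_eq_II.
exact: nc.
Qed.
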